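(* Let $m\in\mathbb{N}$ (with $m\ge1$), $1<q<\infty$, and let $p(\cdot):\mathbb{R}^n\to(0,\infty)$ be a measurable function with $0<p_-\le p_+<\infty$. If $p_{+} \leq n (2m + n/q)^{-1}$, then $\mathcal{H}^{p(\cdot)}_{q, 2m}(\mathbb{R}^{n}) = \{ 0 \}$.
   Context: For a measurable $p(\cdot):\mathbb{R}^n\to(0,\infty)$ put $p_-=\inf_{x} p(x)$, $p_+=\sup_x p(x)$. $L^{p(\cdot)}(\mathbb{R}^n)$ is the space of measurable $f$ such that $\int_{\mathbb{R}^n}|f(x)/\lambda|^{p(x)}dx<\infty$ for some $\lambda>0$. Let $1<q<\infty$. $Q(x,r)$ is the cube centered at $x$ with side length $r$. For $f\in L^q_{loc}(\mathbb{R}^n)$ and a cube $Q$ put $|f|_{q,Q}=\left(|Q|^{-1}\int_Q|f|^q\right)^{1/q}$. For $\gamma>0$ put $\eta_{q,\gamma}(f;x)=\sup_{r>0}r^{-\gamma}|f|_{q,Q(x,r)}$. Write uniquely $\gamma=k+t$ with $k\ge0$ an integer and $0<t\le1$ (so for $\gamma=2m$, $k=2m-1$). $\mathcal{P}_k$ is the space of polynomials of degree at most $k$ and $E^q_k=L^q_{loc}(\mathbb{R}^n)/\mathcal{P}_k$; an element $F\in E^q_k$ is regarded as a coset, and $f\in F$ means $f$ is a representative. For $F\in E^q_k$ put $N_{q,\gamma}(F;x)=\inf\{\eta_{q,\gamma}(f;x):f\in F\}$. Then $\mathcal{H}^{p(\cdot)}_{q,\gamma}(\mathbb{R}^n)$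 is the set of $F\in E^q_k$ with $N_{q,\gamma}(F;\cdot)\in L^{p(\cdot)}(\mathbb{R}^n)$. *)

(* Defs.v *)
From HB Require Import structures.
From mathcomp Require Import all_boot all_order all_algebra.
From mathcomp Require Import all_classical all_reals all_analysis.
From mathcomp Require Import measurable_realfun lra.
(* A plain Import would fail: the notations of mpoly clash with those of
   mathcomp-analysis. *)
From mathcomp Require mpoly.
Import (canonicals, coercions) mpoly.

Set Implicit Arguments.
Unset Strict Implicit.
Unset Printing Implicit Defensive.

Import Order.TTheory GRing.Theory Num.Theory.
Import numFieldNormedType.Exports.

Local Open Scope classical_set_scope.
Local Open Scope ring_scope.

Section lebesgue_step.
Local Open Scope ereal_scope.
Context (R : realType) (n : nat).
Local Notation B := (measurableTypeR R).
Variable m : {sigma_finite_measure set (n.-tuple B) -> \bar R}.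

Definition tuple_cons (z : B * n.-tuple B) : n.+1.-tuple B :=
  [tuple of z.1 :: z.2].

Lemma measurable_tuple_cons : measurable_fun [set: _] tuple_cons.
Proof. exact: measurable_cons measurable_fst measurable_snd. Qed.

Definition lebesgue_step : set (n.+1.-tuple B) -> \bar R :=
  pushforward (@lebesgue_measure R \x m) tuple_cons.

Let step0 : lebesgue_step set0 = 0.
Proof. by rewrite /lebesgue_step /pushforward preimage_set0 measure0. Qed.

Let step_ge0 A : 0 <= lebesgue_step A.
Proof. exact: (measure_ge0 (@lebesgue_measure R \x m)). Qed.

Let step_sigma_additive : semi_sigma_additive lebesgue_step.
Proof.
move=> F mF tF mUF; rewrite /lebesgue_step /pushforward preimage_bigcup.
apply: (measure_semi_sigma_additive (fun k => tuple_cons @^-1` F k)).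
- by move=> k; rewrite -[X in measurable X]setTI; exact: measurable_tuple_cons.
- apply/trivIsetP => /= i j _ _ ij; rewrite -preimage_setI.
  by move/trivIsetP : tF => /(_ _ _ _ _ ij) ->//; rewrite preimage_set0.
- rewrite -preimage_bigcup -[X in measurable X]setTI.
  exact: measurable_tuple_cons.
Qed.

HB.instance Definition _ := isMeasure.Build _ _ _
  lebesgue_step step0 step_ge0 step_sigma_additive.

Let step_sigma_finite : sigma_finite setT lebesgue_step.
Proof.
have /sigma_finiteP[F [TF ndF Foo]] := sigma_finiteT (@lebesgue_measure R).
have /sigma_finiteP[G [TG ndG Goo]] := sigma_finiteT m.
pose u (t : n.+1.-tuple B) : B * n.-tuple B := (thead t, [tuple of behead t]).
have mu : measurable_fun [set: _] u.
  apply: measurable_fun_pair; first exact: measurable_tnth.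
  exact: measurable_behead.
have uK z : u (tuple_cons z) = z.
  by case: z => a t; congr pair; apply/val_inj.
exists (fun k => u @^-1` (F k `*` G k)).
  rewrite -preimage_bigcup (_ : \bigcup_k _ = setT) ?preimage_setT//.
  rewrite -setXTT TF TG predeqE => -[x y]; split.
    by move=> [k _ []/= ? ?]; split; exists k.
  move=> [/= [i _ Fix] [j _ Gjy]]; exists (maxn i j) => //; split.
    by move: x Fix; exact/subsetPset/ndF/leq_maxl.
  by move: y Gjy; exact/subsetPset/ndG/leq_maxr.
move=> k; have [mF Fk] := Foo k; have [mG Gk] := Goo k; split.
  by rewrite -[X in measurable X]setTI; apply: mu => //; exact: measurableX.
rewrite /lebesgue_step /pushforward -comp_preimage.
rewrite (_ : u \o tuple_cons = id) ?preimage_id; last first.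
  by apply/funext => z; exact: uK.
by rewrite product_measure1E// lte_mul_pinfty// ge0_fin_numE.
Qed.

HB.instance Definition _ := Measure_isSigmaFinite.Build _ _ _
  lebesgue_step step_sigma_finite.

End lebesgue_step.

(* Lebesgue measure on the Borel subsets of R^n: lambda_0 is the unit mass at
   the only point of R^0, and lambda_(n+1) is the image of lambda_1 \x lambda_n
   under (a, t) |-> a :: t. *)
Fixpoint lebesgue_tuple (R : realType) (n : nat) :
    {sigma_finite_measure set (n.-tuple (measurableTypeR R)) -> \bar R} :=
  match n with
  | 0 => \d_([tuple] : 0.-tuple (measurableTypeR R))
  | n'.+1 => lebesgue_step (lebesgue_tuple R n')
  end.

Lemma lebesgue_tuple_box (R : realType) n (A : 'I_n -> set (measurableTypeR R)) :
  (forall i, measurable (A i)) ->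
  lebesgue_tuple R n [set x | forall i, A i (tnth x i)] =
  (\prod_(i < n) lebesgue_measure (A i))%E.
Proof.
elim: n A => [|n IH] A mA.
  rewrite big_ord0 /= diracE (_ : _ \in _ = true)//.
  by apply/mem_set => -[].
rewrite big_ord_recl /= /lebesgue_step /pushforward.
rewrite (_ : _ @^-1` _ =
    A ord0 `*` [set x | forall i, A (lift ord0 i) (tnth x i)]); last first.
  apply/seteqP; split=> -[a t] /=.
    by move=> H; split=> [|i]; [have := H ord0|have := H (lift ord0 i); rewrite tnthS].
  by move=> [Ha Ht] i; case: (unliftP ord0 i) => [j|] ->//; rewrite tnthS.
rewrite product_measure1E//.
  congr (_ * _)%E; exact: (IH (fun i => A (lift ord0 i))).
rewrite (_ : [set _ | _] =
    \bigcap_(i in [set: 'I_n]) ((@tnth n _)^~ i @^-1` A (lift ord0 i))).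
  apply: fin_bigcap_measurable => // i _.
  by rewrite -[X in measurable X]setTI; exact: measurable_tnth.
by apply/seteqP; split=> x /= H i; [move=> _|]; exact: H.
Qed.

(* R^n with the sigma-algebra of Lebesgue measurable sets, that is, the
   Caratheodory measurable sets of the outer measure induced by lambda_n. *)
Definition Rn (R : realType) (n : nat) :=
  caratheodory_type ((lebesgue_tuple R n)^*)%mu.
HB.instance Definition _ (R : realType) n := Measurable.on (Rn R n).

Definition lebesgue_Rn (R : realType) (n : nat) : set (Rn R n) -> \bar R :=
  @completed_measure_extension _ _ _ (lebesgue_tuple R n).
HB.instance Definition _ (R : realType) n := Measure.on (@lebesgue_Rn R n).

Lemma lebesgue_Rn_sigma_finite (R : realType) n :
  sigma_finite setT (@lebesgue_Rn R n).
Proof. exact/completed_measure_extension_sigma_finite/sigma_finiteT. Qed.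

HB.instance Definition _ (R : realType) n :=
  Measure_isSigmaFinite.Build _ _ _ (@lebesgue_Rn R n)
    (@lebesgue_Rn_sigma_finite R n).

Section calderon_hardy.
Context (R : realType) (n : nat).
Local Notation Rn := (Rn R n).
Local Notation mu := (@lebesgue_Rn R n).
Implicit Types (x y : Rn) (f g : Rn -> R) (p : Rn -> R) (q gamma r : R).

Definition coord x : 'I_n -> R :=
  fun i => tnth (x : n.-tuple (measurableTypeR R)) i.

Definition cube x r : set Rn :=
  [set y | forall i, `|coord y i - coord x i| <= r / 2].

Definition exponent_inf p : \bar R := ereal_inf [set (p x)%:E | x in [set: Rn]].

Definition exponent_sup p : \bar R := ereal_sup [set (p x)%:E | x in [set: Rn]].

(* Extended values are allowed because Nmax below may be infinite; those of an
   element of Lvar p are finite almost everywhere. *)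
Definition Lvar p : set (Rn -> \bar R) :=
  [set h : Rn -> \bar R | measurable_fun setT h /\
     exists2 lambda : R, 0 < lambda &
       (\int[mu]_x poweR (`|h x| * (lambda^-1)%:E) (p x) < +oo)%E].

Definition Lq_loc q : set (Rn -> R) :=
  [set f : Rn -> R | measurable_fun setT f /\
     forall K : set 'rV[R]_n, compact K ->
       (\int[mu]_(x in [set x | K (\row_i coord x i)]) (`|f x| `^ q)%:E
         < +oo)%E].

Definition Lq_mean q f (Q : set Rn) : \bar R :=
  poweR (((fine (mu Q))^-1)%:E * \int[mu]_(y in Q) (`|f y| `^ q)%:E)%E q^-1.

Definition eta q gamma f x : \bar R :=
  ereal_sup [set ((r `^ (- gamma))%:E * Lq_mean q f (cube x r))%E
            | r in [set r : R | 0 < r]].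

Definition int_part gamma : nat := `|Num.ceil gamma - 1|%N.

Lemma int_partP gamma : 0 < gamma ->
  exists2 t : R, 0 < t <= 1 & gamma = (int_part gamma)%:R + t.
Proof.
move=> g0; have c0 : (0 < Num.ceil gamma)%R by rewrite ceil_gt0.
exists (gamma - (int_part gamma)%:R); last by rewrite addrC subrK.
have -> : (int_part gamma)%:R = (Num.ceil gamma)%:~R - 1 :> R.
  rewrite /int_part natr_absz ger0_norm ?subr_ge0 -?gtz0_ge1//.
  by rewrite rmorphB.
have /andP[? ?] := ceil_itv gamma.
lra.
Qed.

Lemma int_part_nat k : int_part k.+1%:R = k.
Proof. by rewrite /int_part -[_%:R]/(_%:Z%:~R) intrKceil -addn1 PoszD addrK. Qed.

Definition poly_le (k : nat) : set (Rn -> R) :=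
  [set P | exists2 T : mpoly.mpoly n R,
     (mpoly.msize T <= k.+1)%N & P = (fun x => mpoly.meval (coord x) T)].

(* L^q_loc / P_k consists of cosets, each one a set of functions; as elements
   of L^q_loc are functions up to almost everywhere equality, so is the
   relation g - f \in P_k. *)
Definition poly_coset q (k : nat) f : set (Rn -> R) :=
  [set g | Lq_loc q g /\
     exists2 P, poly_le k P & {ae mu, forall x, g x = f x + P x}].

Definition Equot q k : set (set (Rn -> R)) :=
  [set poly_coset q k f | f in Lq_loc q].

Definition Equot_zero q k : set (Rn -> R) := poly_coset q k (fun=> 0).

Definition Nmax q gamma (F : set (Rn -> R)) x : \bar R :=
  ereal_inf [set eta q gamma f x | f in F].

Definition calderon_hardy p q gamma : set (set (Rn -> R)) :=
  [set F | Equot q (int_part gamma) F /\ Lvar p (Nmax q gamma F)].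

End calderon_hardy.

Arguments Equot_zero {R} n q k.

(* Main.v *)
Require Import Defs.
From HB Require Import structures.
From mathcomp Require Import all_boot all_order all_algebra.
From mathcomp Require Import all_classical all_reals all_analysis.
From mathcomp Require Import measurable_realfun ring lra.
From mathcomp Require mpoly.
Import (canonicals, coercions) mpoly.

(** Put a = 2m + n/q. If N = N_{q,2m}(F; .) were at least e |x|^(-a) for all
    large x then, as a p(x) <= n, every dyadic annulus would contribute at least
    a fixed amount to the integral of (N / lambda)^p. So for every e > 0 there
    are x in arbitrarily large boxes of radius s, and representatives g of F,
    with eta(g; x) < e s^(-a); testing on the cube Q(x, 4s), which contains the
    box, the integral of |g|^q over the box is at most C e^q. This gives
    representatives g_i = f + P_i whose integrals over growing boxes are
    summable, hence g_i -> 0 almost everywhere. Thus f is almost everywhere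
    the pointwise limit of the polynomials - P_i of degree at most k, so it is
    itself such a polynomial. *)

Set Implicit Arguments.
Unset Strict Implicit.
Unset Printing Implicit Defensive.

Import Order.TTheory GRing.Theory Num.Theory.
Import numFieldNormedType.Exports.

Local Open Scope classical_set_scope.
Local Open Scope ring_scope.

(** * Pointwise limits in finite-dimensional spaces of functions *)

(** Induction on [d]. Either [b ord0] vanishes on [E] and drops out, or evaluation at a point where
    it does not vanish eliminates it from the [u i] and from the limit [g]. *)
Lemma span_pointwise_closed (T : Type) (R : realType) (E : set T) (d : nat)
    (b : 'I_d -> T -> R) (c : nat -> 'I_d -> R) (u : nat -> T -> R) (g : T -> R) :
  (forall i x, E x -> u i x = \sum_j c i j * b j x) ->
  (forall x, E x -> u ^~ x @ \oo --> g x) ->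
  exists c0 : 'I_d -> R, forall x, E x -> g x = \sum_j c0 j * b j x.
Proof.
elim: d b c u g => [|d IH] b c u g ub ug.
  exists (fun=> 0) => x Ex; rewrite big_ord0.
  have := ug x Ex; rewrite (_ : u ^~ x = fun=> 0).
    by move/cvg_lim => <- //; rewrite lim_cst.
  by apply/funext => i; rewrite ub// big_ord0.
have [b0|] := pselect (forall x, E x -> b ord0 x = 0).
  have [|c0 gc0] := IH (fun j => b (lift ord0 j)) (fun i j => c i (lift ord0 j)) u g _ ug.
    by move=> i x Ex; rewrite ub// big_ord_recl b0// mulr0 add0r.
  exists (fun j => if unlift ord0 j is Some k then c0 k else 0) => x Ex.
  rewrite big_ord_recl unlift_none mul0r add0r gc0//.
  by apply: eq_bigr => j _; rewrite liftK.
move=> /existsNP[x0 /not_implyP[Ex0 /eqP b0]].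
(* [w v] subtracts from [v] the multiple of [b ord0] that makes it vanish at
   [x0]; it kills [b ord0] and preserves pointwise convergence. *)
pose w (v : T -> R) x := v x - v x0 / b ord0 x0 * b ord0 x.
have [||c0 gc0] := IH (fun j => w (b (lift ord0 j)))
    (fun i j => c i (lift ord0 j)) (fun i => w (u i)) (w g).
- move=> i x Ex; rewrite /w !ub// !big_ord_recl.
  rewrite mulrDl mulrDl mulfK// opprD addrACA subrr add0r.
  rewrite !mulr_suml -sumrB; apply: eq_bigr => j _; rewrite mulrBr; congr (_ - _).
  by rewrite !mulrA.
- move=> x Ex; apply: cvgB; first exact: ug.
  by apply: cvgMl; apply: cvgMl; exact: ug.
(* Solving the expansion of [w g] for [g] gives the coefficient of [b ord0]. *)
exists (fun j => if unlift ord0 j is Some k then c0 k else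
   g x0 / b ord0 x0 - \sum_k c0 k * (b (lift ord0 k) x0 / b ord0 x0)) => x Ex.
rewrite big_ord_recl unlift_none.
under [X in _ + X]eq_bigr do rewrite liftK.
have := gc0 x Ex; rewrite /w => /eqP; rewrite subr_eq => /eqP ->.
rewrite (_ : \sum_(i < d) _ = \sum_(i < d) c0 i * b (lift ord0 i) x -
    (\sum_k c0 k * (b (lift ord0 k) x0 / b ord0 x0)) * b ord0 x); first by ring.
by rewrite mulr_suml -sumrB; apply: eq_bigr => j _; ring.
Qed.

(** * Polynomials of degree at most [k] *)

Section poly.
Context (R : realType) (n : nat).
Local Notation Rn := (Rn R n).

Lemma poly_le_sub (k : nat) (P Q : Rn -> R) :
  poly_le k P -> poly_le k Q -> poly_le k (fun x => P x - Q x).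
Proof.
move=> [S Sk ->] [T Tk ->]; exists (S - T).
  rewrite (leq_trans (mpoly.mmeasureD_le _ _ _))// geq_max Sk/=.
  by rewrite mpoly.mmeasureN.
by apply/funext => x; rewrite mpoly.mevalB.
Qed.

Lemma poly_le_zero (k : nat) : @poly_le R n k (fun=> 0).
Proof.
exists 0; first by rewrite mpoly.msize0.
by apply/funext => x; rewrite mpoly.meval0.
Qed.

Lemma poly_le_pointwise_closed (k : nat) (E : set Rn) (u : nat -> Rn -> R)
    (g : Rn -> R) :
  (forall i, poly_le k (u i)) ->
  (forall x, E x -> u ^~ x @ \oo --> g x) ->
  exists2 P, poly_le k P & forall x, E x -> g x = P x.
Proof.
move=> pu; have /choice[T /all_and2[Tk uT]] i : exists T : mpoly.mpoly n R,
    (mpoly.msize T <= k.+1)%N /\ u i = (fun x => mpoly.meval (Defs.coord x) T).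
  by have [T ? ?] := pu i; exists T.
(* For a nonzero polynomial [msize] is the degree plus one, and [bmultinom n k.+1] holds the
   multi-indices of degree less than [k.+1]: the finitely many monomials [b j] span the polynomials
   of degree at most [k]. *)
pose I := mpoly.bmultinom n k.+1.
pose b (j : 'I_#|{: I}|) (x : Rn) : R :=
  mpoly.meval (Defs.coord x) (mpoly.mpolyX R (mpoly.bmnm (enum_val j))).
pose c i (j : 'I_#|{: I}|) : R := mpoly.mcoeff (mpoly.bmnm (enum_val j)) (T i).
move=> /(@span_pointwise_closed _ _ E _ b c u g)[|c0 gc0].
  move=> i x _; rewrite uT [in LHS](@mpoly.mpolywE n R k.+1 (T i) (Tk i)) raddf_sum/=.
  rewrite (reindex (@enum_val _ {: I}))/=; last exact/onW_bij/enum_val_bij.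
  by apply: eq_bigr => j _; rewrite mpoly.mevalZ.
pose S : mpoly.mpoly n R :=
  \sum_(j < #|{: I}|) c0 j *: mpoly.mpolyX R (mpoly.bmnm (enum_val j)).
exists (fun x => mpoly.meval (Defs.coord x) S).
  exists S => //; rewrite (leq_trans (mpoly.mmeasure_sum _ _ _ _))//.
  apply/bigmax_leqP => j _; rewrite (leq_trans (mpoly.msizeZ_le _ _))//.
  by rewrite mpoly.msizeX mpoly.bmdeg.
move=> x /gc0 ->; rewrite raddf_sum/=.
by apply: eq_bigr => j _; rewrite mpoly.mevalZ.
Qed.

End poly.

(** * Divergent integrals, and almost everywhere convergence from summable integrals *)

Section measure_lemmas.
Context d (T : measurableType d) (R : realType) (mu : {measure set T -> \bar R}).
Local Open Scope ereal_scope.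

(* [ge0_le_integral] would require the measurability of [g], and below [g] is
   the integrand of [Lvar], with its variable exponent. *)
Lemma ge0_le_integral_setT (f g : T -> \bar R) :
  (forall x, 0 <= f x) -> (forall x, f x <= g x) ->
  \int[mu]_x f x <= \int[mu]_x g x.
Proof.
move=> f0 fg; have g0 x : 0 <= g x by exact: le_trans (fg x).
rewrite !ge0_integralTE//; apply: ereal_sup_le => _ [h hf <-].
by exists h => // x; exact: le_trans (fg x).
Qed.

(** By disjointness [h] dominates the sum of the [b i * \1_(A i)] over [i < J], whose integral is at
    least [J * c], for every [J]. *)
Lemma trivIset_integral_infty (A : (set T)^nat) (b : R^nat) (c : R)
    (h : T -> \bar R) :
  (0 < c)%R -> (forall i, (0 <= b i)%R) -> (forall i, measurable (A i)) ->
  trivIset setT A -> (forall i, c%:E <= (b i)%:E * mu (A i)) ->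
  (forall x, 0 <= h x) -> (forall i x, A i x -> (b i)%:E <= h x) ->
  \int[mu]_x h x = +oo.
Proof.
move=> c0 b0 mA tA cA h0 bh.
have bnd J : (J%:R * c)%:E <= \int[mu]_x h x.
  apply: (@le_trans _ _ (\int[mu]_x \sum_(i < J) (b i)%:E * (\1_(A i) x)%:E)).
    rewrite ge0_integral_sum//; first last.
    - by move=> i x _; rewrite mule_ge0 ?lee_fin.
    - by move=> i; apply: measurable_funeM; exact/measurable_EFinP.
    apply: (@le_trans _ _ (\sum_(i < J) c%:E)).
      by rewrite sumEFin sumr_const card_ord mulr_natl.
    apply: lee_sum => i _; rewrite ge0_integralZl//.
    - by rewrite integral_indic// setIT.
    - exact/measurable_EFinP.
    - by rewrite lee_fin.
  apply: ge0_le_integral_setT => x.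
    by apply: sume_ge0 => i _; rewrite mule_ge0 ?lee_fin.
  have [[i Ai]|Ax] := pselect (exists i : 'I_J, A i x).
    rewrite (bigD1 i)//= big1 ?adde0; last first.
      move=> j ji; rewrite indicE memNset ?mule0// => Aj.
      move/eqP: ji; apply; apply/val_inj; apply: tA => //; by exists x.
    by rewrite indicE mem_set// mule1 bh.
  rewrite big1 // => i _; rewrite indicE memNset ?mule0// => Ai.
  by apply: Ax; exists i.
apply/eqyP => r _; apply: le_trans (bnd (Num.truncn (r / c)).+1).
by rewrite lee_fin -ler_pdivrMr// ltW// truncnS_gt.
Qed.

Lemma measurable_norm_powR (D : set T) (g : T -> R) (q : R) :
  measurable_fun setT g -> measurable_fun D (fun x => (`|g x| `^ q)%:E).
Proof.
move=> mg; apply: (@measurable_funS _ _ _ _ setT) => //; apply/measurable_EFinP.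
by apply: (measurableT_comp (measurable_powR _)); exact: measurableT_comp.
Qed.

(** The sum of the [|g i| ^ q] cut off to [C i] has a finite integral, so it is finite almost
    everywhere and its terms tend to 0. Each point lies in [C i] for large [i], where the cut-off
    has no effect. *)
Lemma ae_cvg0_summable_integral (g : (T -> R)^nat) (C : (set T)^nat) (q : R) :
  (0 < q)%R -> (forall i, measurable (C i)) ->
  (forall i, measurable_fun setT (g i)) ->
  (forall x, \forall i \near \oo, C i x) ->
  \sum_(0 <= i <oo) \int[mu]_(x in C i) (`|g i x| `^ q)%:E < +oo ->
  {ae mu, forall x, g ^~ x @ \oo --> 0%R}.
Proof.
move=> q0 mC mg Cx sg.
pose h i x := ((fun x => (`|g i x| `^ q)%:E) \_ (C i)) x.
have h0 i x : 0 <= h i x by rewrite /h patchE; case: ifPn; rewrite ?lee_fin// powR_ge0.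
have mh i : measurable_fun setT (h i).
  by apply/(measurable_restrictT _ _).1 => //; exact: measurable_norm_powR.
have : mu.-integrable setT (fun x => \sum_(0 <= i <oo) h i x).
  apply/integrableP; split; first exact: ge0_emeasurable_sum.
  under eq_integral do rewrite gee0_abs ?nneseries_ge0//.
  rewrite integral_nneseries//.
  by under eq_eseriesr do rewrite -integral_mkcond.
move=> /(integrable_ae measurableT); apply: filterS => x /(_ I) hx.
have /nneseries_tail_cvg : \sum_(0 <= i <oo) h i x < +oo.
  by rewrite ltey_eq hx.
move=> /(_ (fun i _ => h0 i x)) tl.
apply/cvgr0Pnorm_lt => e e0.
have e0' : (0 < e `^ q)%R by rewrite powR_gt0.
have near1 : \forall N \near \oo, \sum_(N <= i <oo) h i x < (e `^ q)%:E.
  apply: (tl [set y | y < (e `^ q)%:E]).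
  by apply: open_nbhs_nbhs; split; [exact: open_ereal_lt_ereal|rewrite /= lte_fin].
near=> N.
have CN : C N x by near: N; exact: Cx.
have : \sum_(N <= i <oo) h i x < (e `^ q)%:E by near: N; exact: near1.
(* A nonnegative term is at most the tail that starts with it. *)
move=> hN; have : h N x < (e `^ q)%:E.
  apply: le_lt_trans hN.
  have := @nneseries_lim_ge R (h ^~ x) xpredT N N.+1.
  by rewrite big_nat1; apply.
rewrite /h patchE mem_set// lte_fin.
by rewrite ltNge [in X in _ -> X]ltNge; apply: contra => ?; apply: ge0_ler_powR; rewrite ?nnegrE// ltW.
Unshelve. all: by end_near. Qed.

End measure_lemmas.

(** * Volumes of cubes, and the two estimates at radius [s] *)

Section cubes.
Context (R : realType) (n : nat).
Local Notation Rn := (Rn R n).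
Local Notation mu := (@lebesgue_Rn R n).

Let cube_tupleE (x : Rn) (r : R) : cube x r =
  [set y : n.-tuple (measurableTypeR R) |
    forall i, [set` `[Defs.coord x i - r / 2, Defs.coord x i + r / 2]] (tnth y i)].
Proof.
by apply/seteqP; split=> y /= xy i; have := xy i; rewrite in_itv/= ler_distl.
Qed.

Let measurable_cube_tuple (x : Rn) (r : R) :
  measurable (cube x r : set (n.-tuple (measurableTypeR R))).
Proof.
rewrite cube_tupleE (_ : [set y | _] = \bigcap_(i in [set: 'I_n])
    ((@tnth n _)^~ i @^-1` `[Defs.coord x i - r / 2, Defs.coord x i + r / 2])).
  apply: fin_bigcap_measurable => // i _.
  by rewrite -[X in measurable X]setTI; exact: measurable_tnth.
by apply/seteqP; split=> y /= H i; [move=> _|]; exact: H.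
Qed.

Lemma measurable_cube (x : Rn) (r : R) : measurable (cube x r).
Proof. exact: caratheodory_measurable_mu_ext (measurable_cube_tuple x r). Qed.

(** On Borel sets the completed measure agrees with [lebesgue_tuple], which is multiplicative on
    products of intervals. *)
Lemma lebesgue_cube (x : Rn) (r : R) : 0 < r -> mu (cube x r) = (r ^+ n)%:E.
Proof.
move=> r0; rewrite [LHS](measurable_mu_extE _ (measurable_cube_tuple x r)).
rewrite cube_tupleE; pose A i : set (measurableTypeR R) :=
  [set` `[Defs.coord x i - r / 2, Defs.coord x i + r / 2]].
transitivity (\prod_(i < n) lebesgue_measure (A i))%E.
  by apply: (lebesgue_tuple_box (A := A)) => i; exact: measurable_itv.
rewrite (eq_bigr (fun=> r%:E)) ?prodEFin ?prodr_const ?card_ord// => i _.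
rewrite lebesgue_measure_itv/= lte_fin ifT -?EFinD; last by lra.
by congr EFin; lra.
Qed.

(** The parameter is half the side, whereas that of [cube] is the full side. *)
Definition box (s : R) : set Rn := [set y | forall i, `|Defs.coord y i| <= s].

Let box_cube (s : R) : box s = cube ([tuple of nseq n 0] : Rn) (s * 2).
Proof.
have c0 i : Defs.coord ([tuple of nseq n 0] : Rn) i = 0 :> R.
  by rewrite /Defs.coord tnth_nseq.
apply/seteqP; split=> y /= ys i; have := ys i.
  by rewrite c0 subr0 mulfK.
by rewrite c0 subr0 mulfK.
Qed.

Lemma measurable_box (s : R) : measurable (box s).
Proof. by rewrite box_cube; exact: measurable_cube. Qed.

Lemma lebesgue_box (s : R) : 0 < s -> mu (box s) = ((s * 2) ^+ n)%:E.
Proof. by move=> s0; rewrite box_cube lebesgue_cube// mulr_gt0. Qed.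

Lemma subset_box (s t : R) : s <= t -> box s `<=` box t.
Proof. by move=> st y sy i; exact: le_trans (sy i) st. Qed.

Lemma box_sub_cube (x : Rn) (s : R) : box s x -> box s `<=` cube x (4 * s).
Proof.
move=> sx y sy i; rewrite (le_trans (ler_normB _ _))//.
have := sx i; have := sy i; lra.
Qed.

Lemma box_nearT (x : Rn) : \forall i \near \oo, box (2 ^+ i) x.
Proof.
near=> i => j; apply: (@le_trans _ _ (\sum_k `|Defs.coord x k|)).
  by rewrite (bigD1 j)//= lerDl sumr_ge0.
apply: (@le_trans _ _ i%:R); last first.
  by rewrite -natrX ler_nat ltnW// ltn_expl.
by near: i; exact: nbhs_infty_ger.
Unshelve. all: by end_near. Qed.

(** The volume is [(2 ^ n - 1) * (2 * s) ^ n], and [2 <= 2 ^ n] because [0 < n]. *)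
Lemma lebesgue_box_annulus (s : R) : (0 < n)%N -> 0 < s ->
  (((s * 2) ^+ n)%:E <= mu (box (s * 2) `\` box s))%E.
Proof.
move=> n0 s0; have s20 : 0 < s * 2 by rewrite mulr_gt0.
have muS : (mu (box (s * 2)) < +oo)%E by rewrite lebesgue_box// ltry.
have -> : mu (box (s * 2) `\` box s) = (mu (box (s * 2)) - mu (box s))%E.
  rewrite -[in X in (_ - X)%E](@setIidr _ (box (s * 2)) (box s)).
    exact: measureD (measurable_box _) (measurable_box _) muS.
  by apply: subset_box; lra.
rewrite !lebesgue_box// -EFinB lee_fin.
rewrite lerBrDr -mulr2n -[leLHS]mulr_natl [leRHS]exprMn [leRHS]mulrC.
rewrite ler_wpM2r ?exprn_ge0 ?(ltW s20)// -[leLHS]expr1 ler_weXn2l//; lra.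
Qed.

(** Otherwise, on the annulus of outer radius [s], the integrand is at least
    [(c * s ^ (- a)) ^ (n / a)], that is [c ^ (n / a) * s ^ (- n)]. The annulus has volume at least
    [s ^ n], so each one contributes at least [c ^ (n / a)]. *)
Lemma Lvar_frequently_small (p : Rn -> R) (a : R) (N : Rn -> \bar R) (e : R)
    (k : nat) :
  (0 < n)%N -> 0 < a -> (forall x, 0 < p x) -> (forall x, p x <= n%:R / a) ->
  Lvar p N -> 0 < e ->
  exists j x, [/\ (k <= j)%N, box (2 ^+ j) x & (N x < (e * (2 ^+ j) `^ (- a))%:E)%E].
Proof.
move=> n0 a0 p0 pa [_ [l l0]] + e0; apply: contraPP => /forallNP Ne.
have NE j x : (k <= j)%N -> box (2 ^+ j) x -> ((e * (2 ^+ j) `^ (- a))%:E <= N x)%E.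
  move=> kj jx; rewrite leNgt; apply/negP => Nx.
  by apply: (Ne j); exists x.
pose s i : R := 2 ^+ (k + i).+1.
have s1 i : 1 <= s i by rewrite exprn_ege1//; lra.
have s0 i : 0 < s i by exact: lt_le_trans (s1 i).
(* [e / l] comes from the lower bound on [N / l]. The cap at 1 keeps [c * s i ^ (- a)] in []0, 1]],
   where powers decrease in the exponent, so that [p x] can be raised to [n / a]. *)
pose c := Num.min 1 (e / l).
have c0 : 0 < c by rewrite lt_min ltr01 divr_gt0.
have c1 : c <= 1 by rewrite ge_min lexx.
pose A i := box (s i) `\` box (2 ^+ (k + i)).
rewrite (trivIset_integral_infty (mu := mu) (A := A)
  (b := fun i => c `^ (n%:R / a) * (s i ^+ n)^-1) (c := c `^ (n%:R / a))) //.
- by rewrite powR_gt0.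
- by move=> i; rewrite mulr_ge0 ?powR_ge0// invr_ge0 exprn_ge0// ltW.
- by move=> i; apply: measurableD; exact: measurable_box.
- apply/trivIsetP => i j _ _ ij.
  wlog lt_ij : i j ij / (i < j)%N.
    move=> W; have [|ji|/eqP] := ltngtP i j; [exact: W| |by rewrite (negbTE ij)].
    by rewrite setIC; apply: W; rewrite // eq_sym.
  apply/seteqP; split => // x [[ix _] [_ jx]]; apply: jx.
  apply: subset_box ix; rewrite ler_weXn2l//; first lra.
  by rewrite -addnS leq_add2l.
- move=> i; rewrite EFinM -muleA -[leLHS]mule1; apply: lee_wpmul2l.
    by rewrite lee_fin powR_ge0.
  have := @lebesgue_box_annulus (2 ^+ (k + i)) n0.
  rewrite -exprSr => /(_ (exprn_gt0 _ _)) => /(_ (ltr0Sn _ _)) => H.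
  rewrite -(@mulVf _ (s i ^+ n)) ?expf_neq0 ?gt_eqF// EFinM.
  apply: lee_wpmul2l => //; by rewrite lee_fin invr_ge0 exprn_ge0// ltW.
- by move=> x; exact: poweR_ge0.
move=> i x [ix _].
have NX := NE (k + i).+1 x (leqW (leq_addr _ _)) ix.
have b0 : 0 < c * s i `^ (- a) by rewrite mulr_gt0// powR_gt0.
have b1 : c * s i `^ (- a) <= 1.
  rewrite mulr_ile1 ?powR_ge0 ?(ltW c0)//.
  by rewrite -[leRHS](powRr0 (s i)) ler_powR// oppr_le0 ltW.
apply: (@le_trans _ _ (poweR (c * s i `^ (- a))%:E (p x))); last first.
  apply: gt0_ler_poweR; first exact: ltW.
  - by rewrite in_itv/= leey lee_fin (ltW b0).
  - by rewrite in_itv/= leey mule_ge0// lee_fin invr_ge0 ltW.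
  apply: (@le_trans _ _ ((e * s i `^ (- a))%:E * (l^-1)%:E)%E).
    rewrite -EFinM lee_fin mulrAC ler_wpM2r ?powR_ge0//.
    by rewrite /c ge_min lexx orbT.
  apply: lee_wpmul2r; first by rewrite lee_fin invr_ge0 ltW.
  by apply: (le_trans NX); exact: lee_abs.
rewrite poweR_EFin lee_fin.
apply: (@le_trans _ _ ((c * s i `^ (- a)) `^ (n%:R / a))); last first.
  by apply: ger_powR => //; rewrite b0.
rewrite powRM ?powR_ge0 ?(ltW c0)// -powRrM mulNr (mulrC a) divfK ?gt_eqF//.
by rewrite powRN powR_mulrn// ltW.
Qed.

(** Take [r = 4 * s] in the supremum: [cube x (4 * s)] contains [box s]. Raising to the power [q]
    turns the factor [r ^ gamma] and the volume [r ^ n] into [(4 * s) ^ (gamma * q + n)], and the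
    powers of [s] cancel. *)
Lemma eta_lt_integral (q gamma : R) (g : Rn -> R) (s e : R) (x : Rn) :
  0 < q -> 0 < s -> 0 < e -> measurable_fun setT g -> box s x ->
  (Defs.eta q gamma g x < (e * s `^ (- (gamma + n%:R / q)))%:E)%E ->
  (\int[mu]_(y in box s) (`|g y| `^ q)%:E < (4 `^ (gamma * q + n%:R) * e `^ q)%:E)%E.
Proof.
move=> q0 s0 e0 mg sx.
rewrite ltNge [in X in _ -> X]ltNge; apply: contra => HK.
have r0 : 0 < 4 * s by lra.
apply: le_trans (ereal_sup_ubound _); last by exists (4 * s).
rewrite /Lq_mean lebesgue_cube//=.
have s_ge0 := ltW s0.
have E : (e * s `^ (- (gamma + n%:R / q))) = (4 * s) `^ (- gamma) *
    (((4 * s) ^+ n)^-1 * (4 `^ (gamma * q + n%:R) * e `^ q)) `^ q^-1.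
  have e_ge0 := ltW e0; have qn := gt_eqF q0.
  rewrite -powR_mulrn ?(ltW r0)// -powRN.
  rewrite !powRM ?mulr_ge0 ?powR_ge0// -!powRrM mulfV ?qn// powRr1//.
  rewrite mulrDl mulfK ?qn// opprD !mulNr.
  have D4 : (4 : R) `^ (gamma + n%:R / q) = 4 `^ gamma * 4 `^ (n%:R / q).
    by rewrite powRD//; apply/implyP => _; rewrite pnatr_eq0.
  have Ds : s `^ (- gamma - n%:R / q) = s `^ (- gamma) * s `^ (- (n%:R / q)).
    by rewrite powRD//; apply/implyP => _; rewrite gt_eqF.
  rewrite D4 Ds !powRN.
  have ? : 4 `^ gamma != 0 :> R by rewrite gt_eqF// powR_gt0.
  have ? : 4 `^ (n%:R / q) != 0 :> R by rewrite gt_eqF// powR_gt0.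
  have ? : s `^ gamma != 0 :> R by rewrite gt_eqF// powR_gt0.
  have ? : s `^ (n%:R / q) != 0 :> R by rewrite gt_eqF// powR_gt0.
  by field; apply/and4P.
rewrite E EFinM.
apply: lee_wpmul2l; first by rewrite lee_fin powR_ge0.
have K0 : (0 <= (4 `^ (gamma * q + n%:R) * e `^ q)%:E)%E.
  by rewrite lee_fin mulr_ge0 ?powR_ge0.
have r1 : (0 <= (((4 * s) ^+ n)^-1)%:E)%E.
  by rewrite lee_fin invr_ge0 exprn_ge0// ltW.
have HK' : ((4 `^ (gamma * q + n%:R) * e `^ q)%:E <=
    \int[mu]_(y in cube x (4 * s)) (`|g y| `^ q)%:E)%E.
  apply: (le_trans HK); apply: ge0_subset_integral.
  - exact: measurable_box.
  - exact: measurable_cube.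
  - exact: measurable_norm_powR.
  - by move=> y _; rewrite lee_fin powR_ge0.
  - exact: box_sub_cube.
rewrite -poweR_EFin EFinM; apply: gt0_ler_poweR; first by rewrite invr_ge0 ltW.
- by rewrite in_itv/= leey mule_ge0.
- by rewrite in_itv/= leey mule_ge0// (le_trans K0).
- exact: lee_wpmul2l.
Qed.

End cubes.

(** * The zero coset and the theorem *)

Lemma Lq_loc0 (R : realType) (n : nat) (q : R) :
  0 < q -> Lq_loc q ((fun=> 0) : Rn R n -> R).
Proof.
move=> q0; split=> [|K _]; first exact: measurable_cst.
by rewrite integral0_eq// => x _; rewrite normr0 powR0// gt_eqF.
Qed.

Lemma poly_coset_ae_poly (R : realType) (n : nat) (q : R) (k : nat) (f P : Rn R n -> R) :
  poly_le k P -> {ae @lebesgue_Rn R n, forall x, f x = P x} ->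
  poly_coset q k f = Equot_zero n q k.
Proof.
move=> Pk fP; apply/seteqP; split=> g [Lg [Q Qk gQ]]; split=> //.
(* This is [Q + P], written with differences so that [poly_le_sub] applies. *)
- exists (fun x => Q x - (0 - P x)).
    by apply: poly_le_sub => //; apply: poly_le_sub => //; exact: poly_le_zero.
  by apply: filterS2 fP gQ => x fx gx; rewrite gx fx; ring.
- exists (fun x => Q x - P x); first exact: poly_le_sub.
  by apply: filterS2 fP gQ => x fx gx; rewrite gx fx; ring.
Qed.

(** The representative 0 gives the upper bound. For the lower one, each supremum is at least its
    nonnegative term at [r = 1]. *)
Lemma Nmax_Equot_zero (R : realType) (n : nat) (q gamma : R) (k : nat) (x : Rn R n) :
  0 < q -> Nmax q gamma (Equot_zero n q k) x = 0%E.
Proof.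
move=> q0; apply/eqP; rewrite eq_le; apply/andP; split.
  apply: (@le_trans _ _ (Defs.eta q gamma ((fun=> 0) : Rn R n -> R) x)).
    apply: ereal_inf_lbound; exists (fun=> 0) => //; split; first exact: Lq_loc0.
    exists (fun=> 0); first exact: poly_le_zero.
    by apply: nearW => y; rewrite addr0.
  apply: ge_ereal_sup => _ [r r0 <-].
  rewrite /Lq_mean integral0_eq ?mule0 ?poweR0r ?mule0//.
    by rewrite invr_eq0 gt_eqF.
  by move=> y _; rewrite normr0 powR0// gt_eqF.
apply: le_ereal_inf_tmp => y [f _ <-].
apply: (@le_trans _ _ (((1 : R) `^ (- gamma))%:E * Lq_mean q f (cube x 1))%E).
  by rewrite mule_ge0 ?lee_fin ?powR_ge0 ?poweR_ge0.
by apply: ereal_sup_ubound; exists 1 => //=; exact: ltr01.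
Qed.

Theorem theorem2 (R : realType) (n m : nat) (q : R) (p : Rn R n -> R)
  (n1 : (1 <= n)%N) (m1 : (1 <= m)%N) (q1 : 1 < q)
  (mp : measurable_fun setT p) (p0 : forall x, 0 < p x)
  (pinf : (0 < exponent_inf p)%E) (psup : (exponent_sup p < +oo)%E)
  (ple : (exponent_sup p <= (n%:R * ((2 * m)%:R + n%:R / q)^-1)%:E)%E) :
  calderon_hardy p q (2 * m)%:R =
  [set Equot_zero n q (int_part ((2 * m)%:R : R))].
Proof.
have q0 : 0 < q by lra.
set gamma : R := (2 * m)%:R; set k := int_part gamma.
pose a := gamma + n%:R / q.
have a0 : 0 < a by rewrite ltr_wpDl ?divr_gt0 ?ltr0n// ler0n.
apply/seteqP; split=> F; last first.
  move=> ->; split; first by exists (fun=> 0) => //; exact: Lq_loc0.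
  have -> : Nmax q gamma (Equot_zero n q k) = cst 0%E.
    by apply/funext => x; rewrite Nmax_Equot_zero.
  split; first exact: measurable_cst.
  exists 1 => //; rewrite integral0_eq// => x _.
  suff -> : (`|cst 0%E x| * (1^-1)%:E = 0 :> \bar R)%E by rewrite poweR0r ?gt_eqF.
  by rewrite (_ : `|cst 0%E x|%E = 0%E) ?mul0e//; exact: abse0.
move=> [[f Lf <-]] LN /=.
have pa x : p x <= n%:R / a.
  by rewrite -lee_fin; apply: le_trans ple; apply: ereal_sup_ubound; exists x.
pose K : R := 4 `^ (gamma * q + n%:R).
have K0 : 0 < K by rewrite powR_gt0.
have : forall i, exists g, poly_coset q k f g /\
    (\int[@lebesgue_Rn R n]_(y in box (2 ^+ i)) (`|g y| `^ q)%:E <=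
     (1 / (2 ^ (i + 1))%:R : R)%:E)%E.
  (* [e] solves [K * e ^ q = 1 / 2 ^ (i + 1)], with [K] the constant of [eta_lt_integral]; these
     bounds are summable in [i]. *)
  move=> i; pose e := ((1 / (2 ^ (i + 1))%:R) / K) `^ q^-1.
  have b0 : 0 < (1 / (2 ^ (i + 1))%:R) / K by rewrite !divr_gt0// ltr0n expn_gt0.
  have e0 : 0 < e by rewrite powR_gt0.
  (* The radius [2 ^ j] is not prescribed, but [i <= j] lets the estimate pass to the smaller box of
     radius [2 ^ i]. *)
  have [j [x [ij jx]]] := Lvar_frequently_small i n1 a0 p0 pa LN e0.
  have s0 : 0 < 2 ^+ j :> R by rewrite exprn_gt0.
  move=> /ereal_inf_lt[_ [g fg <-]] /(eta_lt_integral q0 s0 e0) H.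
  exists g; split=> //.
  have mg : measurable_fun setT g by case: fg => -[].
  apply: le_trans (_ : (_ <= \int[@lebesgue_Rn R n]_(y in box (2 ^+ j)) (`|g y| `^ q)%:E)%E) _.
    apply: ge0_subset_integral.
    - exact: measurable_box.
    - exact: measurable_box.
    - exact: measurable_norm_powR.
    - by move=> y _; rewrite lee_fin powR_ge0.
    - by apply: subset_box; rewrite ler_weXn2l// ler1n.
  apply/ltW/(lt_le_trans (H mg jx)).
  rewrite lee_fin -/K /e -powRrM mulVf ?gt_eqF// powRr1 ?(ltW b0)//.
  by rewrite mulrC divfK// gt_eqF.
move=> /choice[g /all_and2[fg gi]].
have mg i : measurable_fun setT (g i) by case: (fg i) => -[].
have /choice[P /all_and2[Pk gP]] i : exists P, poly_le k P /\
    {ae @lebesgue_Rn R n, forall x, g i x = f x + P x}.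
  by have [_ [P Pk gP]] := fg i; exists P.
have g0 : {ae @lebesgue_Rn R n, forall x, g ^~ x @ \oo --> (0 : R)}.
  apply: (@ae_cvg0_summable_integral _ _ _ _ _ (fun i => box (2 ^+ i)) q) => //.
  - by move=> i; exact: measurable_box.
  - exact: box_nearT.
  - apply: (@le_lt_trans _ _ (\sum_(0 <= i <oo) (1 / (2 ^ (i + 1))%:R : R)%:E)%E).
      apply: lee_nneseries => // i _ _.
      by apply: integral_ge0 => x _; rewrite lee_fin powR_ge0.
    by rewrite (cvg_lim _ (@cvg_geometric_eseries_half R 1 0))// ltry.
(* Countably many almost everywhere conditions define [E], so its complement is negligible. On [E]
   the polynomials [- P i = f - g i] tend to [f]. *)
pose E := [set x | (forall i, g i x = f x + P i x) /\ g ^~ x @ \oo --> (0 : R)].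
have [||Q Qk fQ] := @poly_le_pointwise_closed _ _ k E (fun i x => 0 - P i x) f.
- by move=> i; apply: poly_le_sub => //; exact: poly_le_zero.
- move=> x [gx gx0]; rewrite (_ : (fun i => 0 - P i x) = (fun i => f x - g i x)).
    by rewrite -[X in _ --> X]subr0; apply: cvgB => //; exact: cvg_cst.
  by apply/funext => i; rewrite gx; ring.
apply: (@poly_coset_ae_poly _ _ _ _ _ Q) => //.
have /ae_foralln gP' := gP.
by apply: filterS2 gP' g0 => x gx gx0; apply: fQ.
Qed.
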